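(* Let $(\mathcal A,\mu,\alpha)$ be a super-commutative Hom-associative superalgebra. Then there is a compatible Hom-anti-Zinbiel superalgebra structure on $\mathcal A$ (i.e. a Hom-anti-Zinbiel superalgebra $(\mathcal A,\star,\alpha)$ with $\mu(x,y)=x\star y+(-1)^{|x||y|}y\star x$ for all homogeneous $x,y$) if and only if there exists an invertible anti-super-$\mathcal O$-operator $T:V\to\mathcal A$ on $(\mathcal A,\mu,\alpha)$ associated with some representation $(V,\eta,\beta)$ of $(\mathcal A,\mu,\alpha)$.
   Context: All vector spaces are finite-dimensional over a field of characteristic $0$. Superspaces are $\mathbb Z_2$-graded, $|x|$ is the parity of a homogeneous element $x$, and identities are required for homogeneous elements. All structure maps are even (parity preserving). A super-commutative Hom-associative superalgebra is a triple $(\mathcal A,\mu,\alpha)$ with $\mu$ even bilinear and $\alpha$ even linear such that $\mu(x,y)=(-1)^{|x||y|}\mu(y,x)$ and $\mu(\mu(x,y),\alpha(z))=\mu(\alpha(x),\mu(y,z))$. A representation of $(\mathcal A,\mu,\alpha)$ is a triple $(V,\eta,\beta)$ with $V$ a $\mathbb Z_2$-graded vector space, $\beta\in gl(V)$ an even linear map and $\eta:\mathcal A\to gl(V)$ an even linear map such that $\eta(\mu(x,y))\beta=\eta(\alpha(x))\eta(y)$. An anti-super-$\mathcal O$-operator on $(\mathcal A,\mu,\alpha)$ associated with $(V,\eta,\beta)$ is an even linear map $T:V\to\mathcal A$ with $T\circ\beta=\alpha\circ T$ and $\mu(T(u),T(v))=-T\big(\eta(T(u))v+(-1)^{|u||v|}\eta(T(v))u\big)$.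 A Hom-anti-Zinbiel superalgebra is a triple $(\mathcal A,\star,\alpha)$ with $\star$ even bilinear and $\alpha$ even linear such that $\alpha(x)\star(y\star z)=-(x\star y+(-1)^{|x||y|}y\star x)\star\alpha(z)$ and $\alpha(x)\star(y\star z)=(-1)^{|x|(|y|+|z|)}\alpha(y)\star(z\star x)$. *)

(* Defs.v *)
From HB Require Import structures.
From mathcomp Require Import all_boot all_order all_algebra.

Set Implicit Arguments.
Unset Strict Implicit.
Unset Printing Implicit Defensive.

Import GRing.Theory.
Local Open Scope ring_scope.

(* Parities are booleans, with addition (+) on Z/2; [homog V i] is the part of
   parity [i]. The zero vector lies in both parts. *)
Record superspace (F : fieldType) := Superspace {
  superspace_vect :> vectType F;
  homog : bool -> {vspace superspace_vect};
  homog_direct : directv (homog false + homog true);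
  homog_full : (homog false + homog true)%VS = fullv
}.

Definition koszul (F : fieldType) (n : nat) : F := (-1) ^+ n.
Arguments koszul {F} n.

Section SuperDefs.

Variable F : fieldType.
Implicit Types (A V W : superspace F).

Definition hom_of_parity V W (i : bool) (f : 'Hom(V, W)) : Prop :=
  forall (j : bool) (v : V), v \in homog V j -> f v \in homog W (i (+) j).

Definition even_linear V W (f : 'Hom(V, W)) : Prop := hom_of_parity false f.

Definition even_bilinear A (m : {bilinear A -> A -> A}) : Prop :=
  forall (i j : bool) (x y : A),
    x \in homog A i -> y \in homog A j -> m x y \in homog A (i (+) j).

(* gl(V) carries the grading whose parity-i part consists of the endomorphisms
   shifting parity by i. *)
Definition even_to_gl A V (eta : 'Hom(A, 'End(V))) : Prop :=
  forall (i : bool) (x : A), x \in homog A i -> hom_of_parity i (eta x).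

Record supercomm_hom_assoc A (mu : {bilinear A -> A -> A}) (alpha : 'End(A)) :
    Prop := SupercommHomAssoc {
  sha_mu_even : even_bilinear mu;
  sha_alpha_even : even_linear alpha;
  sha_comm : forall (i j : bool) (x y : A),
    x \in homog A i -> y \in homog A j ->
    mu x y = koszul (i * j) *: mu y x;
  sha_assoc : forall (i j k : bool) (x y z : A),
    x \in homog A i -> y \in homog A j -> z \in homog A k ->
    mu (mu x y) (alpha z) = mu (alpha x) (mu y z)
}.

Record representation A (mu : {bilinear A -> A -> A}) (alpha : 'End(A))
    V (eta : 'Hom(A, 'End(V))) (beta : 'End(V)) : Prop := Representation {
  rep_beta_even : even_linear beta;
  rep_eta_even : even_to_gl eta;
  rep_mul : forall (i j : bool) (x y : A),
    x \in homog A i -> y \in homog A j ->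
    (eta (mu x y) \o beta)%VF = (eta (alpha x) \o eta y)%VF
}.

Record anti_super_O_operator A (mu : {bilinear A -> A -> A}) (alpha : 'End(A))
    V (eta : 'Hom(A, 'End(V))) (beta : 'End(V)) (T : 'Hom(V, A)) : Prop :=
    AntiSuperOOperator {
  aso_even : even_linear T;
  aso_comm : (T \o beta)%VF = (alpha \o T)%VF;
  aso_mul : forall (i j : bool) (u v : V),
    u \in homog V i -> v \in homog V j ->
    mu (T u) (T v) = - T (eta (T u) v + koszul (i * j) *: eta (T v) u)
}.

Record hom_anti_zinbiel A (star : {bilinear A -> A -> A}) (alpha : 'End(A)) :
    Prop := HomAntiZinbiel {
  haz_star_even : even_bilinear star;
  haz_alpha_even : even_linear alpha;
  haz_anti : forall (i j k : bool) (x y z : A),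
    x \in homog A i -> y \in homog A j -> z \in homog A k ->
    star (alpha x) (star y z)
    = - star (star x y + koszul (i * j) *: star y x) (alpha z);
  haz_cyclic : forall (i j k : bool) (x y z : A),
    x \in homog A i -> y \in homog A j -> z \in homog A k ->
    star (alpha x) (star y z)
    = koszul (i * (j + k)) *: star (alpha y) (star z x)
}.

Definition compatible A (mu star : {bilinear A -> A -> A}) : Prop :=
  forall (i j : bool) (x y : A),
    x \in homog A i -> y \in homog A j ->
    mu x y = star x y + koszul (i * j) *: star y x.

End SuperDefs.

(* Main.v *)
(** If [T : V -> A] is an invertible anti-super-O-operator, the product is
    [x * y = - T (eta x (T^-1 y))]; conversely, for a compatible product the
    identity of [A] is an operator for [eta x = - (x * _)].  The only identity
    that is not a transport of structure is the cyclic one: rewriting both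
    sides of the Hom-associativity of [mu] by compatibility and the first
    anti-Zinbiel identity, all terms in [alpha z * (x * y)] cancel and twice the
    cyclic identity remains, so it follows as [2] is invertible. *)

Require Import Defs.
From HB Require Import structures.
From mathcomp Require Import all_boot all_order all_algebra.

Import GRing.Theory.
Local Open Scope ring_scope.

Lemma koszulK (F : fieldType) (n : nat) : koszul n * koszul n = 1 :> F.
Proof. by rewrite /koszul -expr2 sqrr_sign. Qed.

(** A sign depends only on its exponent modulo 2, so [(+)] on parities acts there as ordinary
    addition. *)
Lemma koszul_addb (F : fieldType) (i j k : bool) :
  koszul ((i (+) j) * k) = koszul (i * k) * koszul (j * k) :> F.
Proof. by case: i j k => [] [] []; rewrite /koszul ?mulr1 ?mul1r // mulrNN mulr1. Qed.

Lemma homog_ind {F : fieldType} {V : superspace F} (P : V -> Prop) :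
  (forall u v, P u -> P v -> P (u + v)) ->
  (forall (i : bool) v, v \in homog V i -> P v) -> forall v, P v.
Proof.
move=> Padd Phomog v.
have: v \in (homog V false + homog V true)%VS by rewrite homog_full memvf.
by case/memv_addP=> u Vu [w Vw ->]; apply: Padd; [apply: Phomog Vu | apply: Phomog Vw].
Qed.

(** The homogeneous vectors span [V]. This brings [rep_mul], an equality of endomorphisms, down to
    homogeneous arguments, where the identities of [star] apply. *)
Lemma eq_lfun_homog {F : fieldType} {V : superspace F} {W : vectType F}
    (f g : 'Hom(V, W)) :
  (forall (i : bool) v, v \in homog V i -> f v = g v) -> f = g.
Proof.
move=> fg; apply/lfunP; apply: homog_ind => [u v fgu fgv|//].
by rewrite !linearD /= fgu fgv.
Qed.

(** Serves to show that [T^-1] is even. Split [v = u + w] with [u] of parity [i] and [w] of the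
    other: [f w = f v - f u] has both parities, hence vanishes, and injectivity gives [w = 0]. *)
Lemma even_bijective_homog {F : fieldType} {V W : superspace F}
    {f : 'Hom(V, W)} {i : bool} {v : V} :
  even_linear f -> injective f -> f v \in homog W i -> v \in homog V i.
Proof.
move=> f_even f_inj Wfv.
have: v \in (homog V i + homog V (~~ i))%VS.
  by case: (i); [rewrite addvC|]; rewrite homog_full memvf.
case/memv_addP=> u Vu [w Vw def_v]; rewrite {}def_v in Wfv *.
have Wfw : f w \in homog W i.
  by rewrite -(addKr (f u) (f w)) -linearD memvD // memvN (f_even _ _ Vu).
have : f w \in (homog W i :&: homog W (~~ i))%VS.
  by rewrite memv_cap Wfw (f_even _ _ Vw).
have -> : (homog W i :&: homog W (~~ i) = 0)%VS.
  have /directv_addP := homog_direct W.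
  by case: (i); rewrite //= capvC.
rewrite memv0 -(linear0 f) => /eqP/f_inj ->.
by rewrite addr0.
Qed.

Lemma anti_zinbiel_cyclic {F : fieldType} {A : superspace F}
    {mu star : {bilinear A -> A -> A}} {alpha : 'End(A)} :
  (2%:R != 0 :> F) -> supercomm_hom_assoc mu alpha -> compatible mu star ->
  (forall (i j k : bool) (x y z : A),
    x \in homog A i -> y \in homog A j -> z \in homog A k ->
    star (alpha x) (star y z) = - star (mu x y) (alpha z)) ->
  forall (i j k : bool) (x y z : A),
    x \in homog A i -> y \in homog A j -> z \in homog A k ->
    star (alpha x) (star y z)
    = koszul (i * (j + k)) *: star (alpha y) (star z x).
Proof.
move=> two_neq0 hA comp anti i j k x y z Ax Ay Az.
(* Super-commutativity of [mu], read through [anti], exchanges the first two factors up to sign. *)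
have swap (a b c : bool) (u v w : A) :
    u \in homog A a -> v \in homog A b -> w \in homog A c ->
    star (alpha u) (star v w) = koszul (a * b) *: star (alpha v) (star u w).
  move=> Au Av Aw; rewrite (anti _ _ _ _ _ _ Au Av Aw) (anti _ _ _ _ _ _ Av Au Aw).
  by rewrite (sha_comm hA Au Av) linearZl_LR scalerN.
have alphaP c u : u \in homog A c -> alpha u \in homog A c.
  exact: (sha_alpha_even hA).
have := sha_assoc hA Ax Ay Az.
rewrite (comp _ _ _ _ (sha_mu_even hA Ax Ay) (alphaP _ _ Az)).
rewrite (comp _ _ _ _ (alphaP _ _ Ax) (sha_mu_even hA Ay Az)).
rewrite -[star (mu x y) _]opprK -(anti _ _ _ _ _ _ Ax Ay Az).
rewrite -[star (mu y z) _]opprK -(anti _ _ _ _ _ _ Ay Az Ax).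
rewrite (comp _ _ _ _ Ax Ay) (comp _ _ _ _ Ay Az) !linearDr !linearZr_LR /=.
rewrite (swap _ _ _ _ _ _ Az Ay Ax) (swap _ _ _ _ _ _ Ax Az Ay).
rewrite koszul_addb [(i * (j (+) k))%N]mulnC koszul_addb ![(_ * i)%N]mulnC [(k * j)%N]mulnC.
rewrite /koszul mulnDr exprD -!/(koszul _).
set P := star (alpha x) _; set Q := star (alpha y) _; set R := star (alpha z) _.
rewrite scalerDr !scalerA scalerN [koszul (j * k) * _]mulrC.
rewrite [_ * koszul (i * j) * _]mulrAC -[_ * koszul (j * k) * koszul (j * k)]mulrA.
rewrite koszulK mulr1 [koszul (i * k) * koszul (i * j)]mulrC.
(* Associativity now reads [- P + t *: R + s *: Q = P + t *: R - s *: Q], where [s] is also the sign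
   in the goal. Hence [P - s *: Q] equals its own opposite and its double is zero. *)
set s := _ * koszul (i * k); set t := koszul (i * k) * _.
rewrite addrCA [P + t *: R]addrC -[_ + P - _]addrA => /addrI eqPQ.
apply/eqP; rewrite -subr_eq0 -[_ == _](orFb) -(negbTE two_neq0) -scaler_eq0.
by rewrite scaler_nat mulr2n -{1}eqPQ addrACA addNr subrr addr0.
Qed.

(** [T^-1] is a linear pseudo-inverse, a true inverse once [T] is bijective. The minus sign is that
    of the operator identity, which thus becomes compatibility. *)
Definition transported_product {F : fieldType} {A V : superspace F}
    (eta : 'Hom(A, 'End(V))) (T : 'Hom(V, A)) (x y : A) : A :=
  - T (eta x ((T^-1)%VF y)).

Lemma transported_product_bilinear {F : fieldType} {A V : superspace F}
    (eta : 'Hom(A, 'End(V))) (T : 'Hom(V, A)) :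
  bilinear_for *:%R *:%R (transported_product eta T).
Proof.
rewrite /transported_product; split=> u a x y.
  by rewrite /= linearP add_lfunE scale_lfunE linearP opprD scalerN.
by rewrite /= !linearP.
Qed.

HB.instance Definition _ (F : fieldType) (A V : superspace F)
    (eta : 'Hom(A, 'End(V))) (T : 'Hom(V, A)) :=
  bilinear_isBilinear.Build F A A A *:%R *:%R (transported_product eta T)
    (transported_product_bilinear eta T).

(** The sign survives in one such map and cancels in a composite of two; this absorbs the minus of
    [haz_anti] into [rep_mul]. *)
Definition opp_left_mul {F : fieldType} {A : superspace F}
    (star : {bilinear A -> A -> A}) (x : A) : 'End(A) := - linfun (star x).

Lemma opp_left_mul_linear {F : fieldType} {A : superspace F}
    (star : {bilinear A -> A -> A}) :
  linear (opp_left_mul star).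
Proof.
move=> a x y; apply/lfunP=> z.
by rewrite add_lfunE scale_lfunE !opp_lfunE !lfunE /= linearPl opprD scalerN.
Qed.

HB.instance Definition _ (F : fieldType) (A : superspace F)
    (star : {bilinear A -> A -> A}) :=
  GRing.isLinear.Build F A 'End(A) *:%R (opp_left_mul star)
    (opp_left_mul_linear star).

(** The representation identity is [haz_anti]; the operator identity is compatibility, its minus
    cancelling the one in [eta]. *)
Lemma anti_super_O_operator_of_zinbiel {F : fieldType} {A : superspace F}
    {mu star : {bilinear A -> A -> A}} {alpha : 'End(A)} :
  hom_anti_zinbiel star alpha -> compatible mu star ->
  exists eta : 'Hom(A, 'End(A)),
    representation mu alpha eta alpha /\
    anti_super_O_operator mu alpha eta alpha \1%VF.
Proof.
move=> hZ comp; exists (linfun (opp_left_mul star)).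
have etaE x y : linfun (opp_left_mul star) x y = - star x y.
  by rewrite lfunE /= opp_lfunE lfunE.
split; split.
- exact: (haz_alpha_even hZ).
- by move=> i x Ax j y Ay; rewrite etaE memvN (haz_star_even hZ).
- move=> i j x y Ax Ay; apply: eq_lfun_homog => k z Az.
  rewrite !comp_lfunE !etaE linearNr opprK (haz_anti hZ Ax Ay Az).
  by rewrite (comp _ _ _ _ Ax Ay).
- by move=> i x Ax; rewrite id_lfunE.
- by rewrite comp_lfun1l comp_lfun1r.
move=> i j x y Ax Ay; rewrite !id_lfunE !etaE (comp _ _ _ _ Ax Ay).
by rewrite scalerN -opprD opprK.
Qed.

Lemma zinbiel_of_anti_super_O_operator {F : fieldType} {A V : superspace F}
    {mu : {bilinear A -> A -> A}} {alpha : 'End(A)}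
    {eta : 'Hom(A, 'End(V))} {beta : 'End(V)} {T : 'Hom(V, A)} :
  (2%:R != 0 :> F) -> supercomm_hom_assoc mu alpha ->
  representation mu alpha eta beta ->
  anti_super_O_operator mu alpha eta beta T -> bijective T ->
  exists star : {bilinear A -> A -> A},
    hom_anti_zinbiel star alpha /\ compatible mu star.
Proof.
move=> two_neq0 hA hV hT T_bij.
pose star : {bilinear A -> A -> A} := transported_product eta T.
have T_inj := bij_inj T_bij.
have TK : cancel T (T^-1)%VF by apply/lker0_lfunK/lker0P.
have TVK : cancel (T^-1)%VF T by apply/(bij_can_sym T_bij).
have TV_even i x : x \in homog A i -> (T^-1)%VF x \in homog V i.
  by move=> Ax; apply: (even_bijective_homog (aso_even hT) T_inj); rewrite TVK.
have T_beta v : T (beta v) = alpha (T v).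
  by rewrite -!comp_lfunE (aso_comm hT).
have starE x y : star x y = - T (eta x ((T^-1)%VF y)) by [].
have comp : compatible mu star.
  move=> i j x y Ax Ay; rewrite -[x in LHS]TVK -[y in LHS]TVK.
  rewrite (aso_mul hT (TV_even _ _ Ax) (TV_even _ _ Ay)) !TVK.
  by rewrite !starE linearD linearZ opprD scalerN.
have star_even : even_bilinear star.
  move=> i j x y Ax Ay; rewrite starE memvN; apply: (aso_even hT).
  exact: (rep_eta_even hV Ax (TV_even _ _ Ay)).
have anti (i j k : bool) (x y z : A) :
    x \in homog A i -> y \in homog A j -> z \in homog A k ->
    star (alpha x) (star y z) = - star (mu x y) (alpha z).
  move=> Ax Ay Az; rewrite !starE [(T^-1)%VF (- _)]linearN /= TK
    [eta (alpha x) _]linearN [T (- _)]linearN !opprK /=.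
  (* Passing [alpha] through [T] as [beta] makes both sides images under [T] of composites applied
     to [T^-1 z], which [rep_mul] identifies. *)
  have -> : alpha z = T (beta ((T^-1)%VF z)) by rewrite T_beta TVK.
  by rewrite TK -[eta (mu x y) _]comp_lfunE (rep_mul hV Ax Ay) comp_lfunE.
exists star; split=> //; split=> //.
- exact: (sha_alpha_even hA).
- move=> i j k x y z Ax Ay Az.
  by rewrite (anti _ _ _ _ _ _ Ax Ay Az) (comp _ _ _ _ Ax Ay).
exact: anti_zinbiel_cyclic two_neq0 hA comp anti.
Qed.

Theorem theorem3p2 (F : fieldType) (charF0 : [pchar F] =i pred0)
    (A : superspace F) (mu : {bilinear A -> A -> A}) (alpha : 'End(A))
    (hA : supercomm_hom_assoc mu alpha) :
  (exists star : {bilinear A -> A -> A},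
     hom_anti_zinbiel star alpha /\ compatible mu star)
  <->
  (exists (V : superspace F) (eta : 'Hom(A, 'End(V))) (beta : 'End(V))
          (T : 'Hom(V, A)),
     [/\ representation mu alpha eta beta,
         anti_super_O_operator mu alpha eta beta T
       & bijective T]).
Proof.
split.
  case=> star [hZ /(anti_super_O_operator_of_zinbiel hZ) [eta [hV hT]]].
  exists A, eta, alpha, \1%VF; split=> //.
  by exists id => x; rewrite id_lfunE.
case=> V [eta [beta [T [hV hT T_bij]]]].
apply: zinbiel_of_anti_super_O_operator hA hV hT T_bij.
by rewrite ((pcharf0P F).1 charF0).
Qed.
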